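(* (1) Let $(X,T)$ be a topological dynamical system. If a point $x\in X$ is piecewise syndetic recurrent, then for every neighborhood $U$ of $x$, the set $N(x,U)$ is a quasi-central subset of $\mathbb{N}_0$. (2) For any quasi-central subset $F$ of $\mathbb{N}_0$, there exist a topological dynamical system $(X,T)$, a piecewise syndetic recurrent point $x\in X$ and a neighborhood $U$ of $x$ such that $N(x,U)\subset F\cup\{0\}$.
   Context: $\mathbb{N}_0$ is the set of non-negative integers and $\mathbb{N}$ the set of positive integers. A topological dynamical system is a pair $(X,T)$ where $X$ is a compact metric space and $T\colon X\to X$ is a continuous map. ''Neighborhood'' always means open neighborhood. For $x\in X$ and $U\subset X$, $N(x,U)=\{n\in\mathbb{N}_0: T^nx\in U\}$. A set $A\subset\mathbb{N}_0$ is thick if for every $L\in\mathbb{N}$ there is $n\in\mathbb{N}_0$ with $\{n,n+1,\dots,n+L\}\subset A$; syndetic if there is $L\in\mathbb{N}$ such that $\{n,n+1,\dots,n+L\}\cap A\neq\emptyset$ for all $n\in\mathbb{N}_0$; piecewise syndetic if $A=B\cap C$ with $B\subset \mathbb{N}_0$ thick and $C\subset \mathbb{N}_0$ syndetic. A point $x\in X$ is piecewise syndetic recurrent if $N(x,U)$ is piecewise syndetic for every neighborhood $U$ of $x$. $\beta\mathbb{N}_0$ is the Stone-Čech compactification of the discrete space $\mathbb{N}_0$, i.e. the set of ultrafilters on $\mathbb{N}_0$ with basis of open sets $\{p\in\beta\mathbb{N}_0: A\in p\}$, $A\subset\mathbb{N}_0$, and with the operation $p+q=\{F\subset\mathbb{N}_0:\{n\in\mathbb{N}_0: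 -n+F\in q\}\in p\}$, where $-n+F=\{m\in\mathbb{N}_0: n+m\in F\}$. This is a compact Hausdorff right topological semigroup; $K(\beta\mathbb{N}_0)$ denotes its smallest (two-sided) ideal and $\operatorname{cl}$ denotes closure in $\beta\mathbb{N}_0$. A set $F\subset\mathbb{N}_0$ is quasi-central if there is $p\in\operatorname{cl}(K(\beta\mathbb{N}_0))$ with $p+p=p$ and $F\in p$. *)

(* Defs.v *)
From HB Require Import structures.
From mathcomp Require Import all_boot all_order all_algebra.
From mathcomp Require Import all_classical all_reals.
From mathcomp Require Import topology.

Set Implicit Arguments.
Unset Strict Implicit.
Unset Printing Implicit Defensive.

Local Open Scope classical_set_scope.
Local Open Scope nat_scope.

Definition thick (A : set nat) : Prop :=
  forall L, 0 < L -> exists n, forall k, k <= L -> A (n + k).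

Definition syndetic (A : set nat) : Prop :=
  exists2 L, 0 < L & forall n, exists2 k, k <= L & A (n + k).

Definition piecewise_syndetic (A : set nat) : Prop :=
  exists B C : set nat, [/\ thick B, syndetic C & A = B `&` C].

Definition topological_dynamical_system (R : realType) (X : metricType R)
  (T : X -> X) : Prop := compact [set: X] /\ continuous T.

Definition return_times (X : Type) (T : X -> X) (x : X) (U : set X) : set nat :=
  [set n | U (iter n T x)].

Definition piecewise_syndetic_recurrent (X : topologicalType) (T : X -> X)
  (x : X) : Prop :=
  forall U : set X, open_nbhs x U -> piecewise_syndetic (return_times T x U).

(* Stone-Cech compactification of the discrete space of natural numbers, with
   the topology generated by the sets [betaN_basic A] below *)
Record betaN := BetaN {
  betaN_sets :> set nat -> Prop;
  betaN_ultra : UltraFilter betaN_sets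
}.

#[global] Existing Instance betaN_ultra.

HB.instance Definition _ := gen_eqMixin betaN.
HB.instance Definition _ := gen_choiceMixin betaN.

Lemma betaN_eq (p q : betaN) : betaN_sets p = betaN_sets q -> p = q.
Proof.
by case: p q => [p pU] [q qU] /= E; subst q; rewrite (Prop_irrelevance pU qU).
Qed.

Definition betaN_basic (A : set nat) : set betaN := [set p : betaN | p A].

Lemma betaN_basic_cover : \bigcup_(A in [set: set nat]) betaN_basic A = setT.
Proof. by apply/seteqP; split=> // p _; exists setT => //; exact: filterT. Qed.

Lemma betaN_basic_join (A B : set nat) (p : betaN) :
  [set: set nat] A -> [set: set nat] B -> betaN_basic A p -> betaN_basic B p ->
  exists C, [/\ [set: set nat] C, betaN_basic C p &
    betaN_basic C `<=` betaN_basic A `&` betaN_basic B].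
Proof.
move=> _ _ pA pB; exists (A `&` B); split=> //; first exact: filterI.
by move=> q qAB; split; apply: filterS qAB => n [].
Qed.

HB.instance Definition _ := isBaseTopological.Build betaN
  betaN_basic_cover betaN_basic_join.

Lemma betaN_basic_basis : basis (range betaN_basic).
Proof.
have op A : open (betaN_basic A).
  by exists [set A] => //; rewrite bigcup_set1.
split=> [_ [A _ <-]|p U]; first exact: op.
rewrite nbhsE /= => -[V [[D _ <-] [A DA pA]] DU].
exists (betaN_basic A); first by split=> //; exists A.
by move=> q qA; apply: DU; exists A.
Qed.

Lemma ultra_of_dichotomy (T : Type) (G : set_system T) :
  ProperFilter G -> (forall A, G A \/ G (~` A)) -> UltraFilter G.
Proof.
move=> GF dich; split=> // H HF GH; apply/seteqP; split=> // A HA.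
have [//|/GH HnA] := dich A.
by case: (filter_not_empty H); rewrite -(setICr A); exact: filterI.
Qed.

(* -n + F *)
Definition translate (n : nat) (F : set nat) : set nat := [set m | F (n + m)].

Definition betaN_add_sets (p q : betaN) : set_system nat :=
  [set F | p [set n | q (translate n F)]].

Lemma betaN_add_ultra (p q : betaN) : UltraFilter (betaN_add_sets p q).
Proof.
pose P := betaN_sets p; pose Q := betaN_sets q.
apply: ultra_of_dichotomy => [|A]; last first.
  have [|pA] := in_ultra_setVsetC [set n | Q (translate n A)] (betaN_ultra p).
    by left.
  right; apply: (@filterS _ P _ _ _ _ pA) => n /= nqA.
  by have [] := in_ultra_setVsetC (translate n A) (betaN_ultra q).
apply: Build_ProperFilter; [move=> p0|split].
- apply: (@filter_not_empty _ P); apply: (@filterS _ P _ _ _ _ p0) => n.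
  exact: (@filter_not_empty _ Q).
- by apply: (@filterE _ P) => n; exact: (@filterT _ Q).
- move=> A B pA pB; apply: (@filterS2 _ P _ _ _ _ _ pA pB) => n /=.
  exact: (@filterI _ Q).
- move=> A B AB; apply: (@filterS _ P) => n /=; apply: (@filterS _ Q) => m.
  exact: AB.
Qed.

Definition betaN_add (p q : betaN) : betaN := BetaN (betaN_add_ultra p q).

Definition betaN_ideal (I : set betaN) : Prop :=
  I !=set0 /\ forall p q, I q -> I (betaN_add p q) /\ I (betaN_add q p).

Definition betaN_K : set betaN := \bigcap_(I in betaN_ideal) I.

(* betaN_K is the smallest two-sided ideal as soon as there is one. *)
Lemma betaN_K_smallest (J : set betaN) :
  betaN_ideal J -> (forall I, betaN_ideal I -> J `<=` I) -> betaN_K = J.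
Proof.
move=> idJ minJ; apply/seteqP; split=> [p Kp|p Jp I idI]; first exact: Kp.
exact: minJ Jp.
Qed.

Definition quasi_central (F : set nat) : Prop :=
  exists p : betaN, [/\ closure betaN_K p, betaN_add p p = p & p F].

(* Main.v *)
From HB Require Import structures.
Require Import Defs.
From mathcomp Require Import all_boot all_order all_algebra.
From mathcomp Require Import all_classical all_reals.
From mathcomp Require Import topology.
From mathcomp Require Import zify.

Set Implicit Arguments.
Unset Strict Implicit.
Unset Printing Implicit Defensive.

(** The bridge between ultrafilters and return times is the identity
    [closure_betaN_KE]: an ultrafilter lies in the closure of the smallest
    ideal K exactly when all its members are piecewise syndetic. One half holds
    because the ultrafilters with piecewise syndetic members form a two-sided
    ideal. The other half finds, for A = B `&` C with B thick and C syndetic, a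
    minimal left ideal inside the closed left ideal of those p that contain
    all translates of B; finitely many translates of C cover the integers, so
    some element of that minimal left ideal contains C as well.

    Part (1). For a piecewise syndetic recurrent x, the ultrafilters in the
    closure of K that contain N(x,U) for every neighborhood U of x form a
    closed set, nonempty by compactness. It is a semigroup: the closure of K is
    an ideal by the identity above, and if T^n x lies in U, then N(x, T^-n U),
    which is the translate of N(x,U) by n, is again a set of return times of x
    to a neighborhood of x. A closed semigroup contains an idempotent (the
    Ellis-Numakura lemma, [exists_idempotent]), and that idempotent witnesses
    that every N(x,U) is quasi-central.

    Part (2). Let p be an idempotent in the closure of K with F in p, and let
    S be the set of the n in F with -n+F in p. Then S is in p, and so is -n+S
    for n in S. Hence, for a finite 0-1 word u whose ones, except possibly the
    one at position 0, lie in S, the positions n at which a copy of u may be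
    put without creating a one outside S form a member of p; this set is
    therefore piecewise syndetic. One builds an infinite 0-1 sequence x with
    x(0) = 1 as a limit of such words: each stage extends the current word by
    many copies of one of its own prefixes, each prefix being served at
    infinitely many stages and always with the same gap
    ([exists_recurrent_sequence]). The sequence x is piecewise syndetic
    recurrent for the shift on the Cantor space, and its return times to
    U = {y : y(0) = 1} are its ones. *)

Local Open Scope classical_set_scope.
Local Open Scope nat_scope.

(** * Piecewise syndetic sets of integers *)

(** Replaces the two auxiliary sets by one gap bound g that works on
    arbitrarily long intervals. In the converse direction, the thick set adds
    to A the points followed by A within g steps, and the syndetic set adds to
    A the points that are not. *)
Lemma piecewise_syndeticP (A : set nat) :
  piecewise_syndetic A <->
  exists g, forall M, exists a, forall i, i <= M ->
    exists2 k, k <= g & A (a + i + k).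
Proof.
split=> [[B [C [thB [g _ synC] ->]]]|[g gapA]].
  exists g => M; have [a aB] := thB (M + g).+1 isT; exists a => i iM.
  have [k kg Ck] := synC (a + i); exists k => //; split=> //.
  by rewrite -addnA; apply: aB; rewrite leqW// leq_add.
pose B := [set n | exists2 k, k <= g & A (n + k)].
exists (A `|` B), (A `|` ~` B); split.
- by move=> L _; have [a aA] := gapA L; exists a => k kL; right; exact: aA.
- exists g.+1 => // n; have [[k kg Ak]|nB] := pselect (B n).
    by exists k; [exact: leqW|left].
  by exists 0 => //; rewrite addn0; right.
- by rewrite -setUIr setICr setU0.
Qed.

Lemma piecewise_syndeticS (A B : set nat) :
  A `<=` B -> piecewise_syndetic A -> piecewise_syndetic B.
Proof.
move=> AB /piecewise_syndeticP[g gA]; apply/piecewise_syndeticP.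
exists g => M; have [a aA] := gA M; exists a => i /aA[k kg Ak].
by exists k => //; exact: AB.
Qed.

Lemma piecewise_syndetic_translate n (A : set nat) :
  piecewise_syndetic (translate n A) -> piecewise_syndetic A.
Proof.
move=> /piecewise_syndeticP[g gA]; apply/piecewise_syndeticP.
exists g => M; have [a aA] := gA M; exists (n + a) => i /aA[k kg Ak].
by exists k => //; rewrite -!addnA; move: Ak; rewrite /translate/= -!addnA.
Qed.

Lemma filter_forall_leq (T : Type) (F : set_system T) (P : nat -> set T) M :
  Filter F -> (forall i, i <= M -> F (P i)) ->
  F [set t | forall i, i <= M -> P i t].
Proof.
move=> FF; elim: M => [|M IH] FP.
  by have := FP 0 isT; apply: filterS => t Pt i; rewrite leqn0 => /eqP ->.
have FPM := FP M.+1 (leqnn _); have FPi := IH (fun i iM => FP i (leqW iM)).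
apply: filterS2 FPi FPM => t Pt PM i; rewrite leq_eqVlt => /orP[/eqP -> //|].
exact: Pt.
Qed.

(** Membership in F of finitely many translates of A is witnessed by a single
    shift, so every long interval on which the n with -n+A in F have
    bounded gaps moves to one on which A has bounded gaps. *)
Lemma piecewise_syndetic_translate_mem (F : set_system nat) (A : set nat) :
  ProperFilter F -> piecewise_syndetic [set n | F (translate n A)] ->
  piecewise_syndetic A.
Proof.
move=> FF /piecewise_syndeticP[g gA]; apply/piecewise_syndeticP.
exists g => M; have [a aA] := gA M.
pose P i := [set m | exists2 k, k <= g & A (a + i + k + m)].
have /filter_ex[m Pm] : F [set m | forall i, i <= M -> P i m].
  apply: filter_forall_leq => i /aA[k kg Fk]; apply: filterS Fk => m Am.
  by exists k.
exists (a + m) => i /Pm[k kg Ak]; exists k => //.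
by rewrite (addnAC a) (addnAC (a + i)).
Qed.

(** * The compact right topological semigroup of ultrafilters *)

(** Ultrafilters are maximal among proper filters. *)
Lemma betaN_sub_eq (p q : betaN) : (forall A, p A -> q A) -> p = q.
Proof.
move=> pq; apply: betaN_eq; apply/esym/max_filter => //.
Qed.

Lemma betaN_addA (p q r : betaN) :
  betaN_add p (betaN_add q r) = betaN_add (betaN_add p q) r.
Proof.
apply: betaN_sub_eq => A; rewrite /betaN_add /= /betaN_add_sets /=.
apply: filterS => n /=; apply: filterS => m /=; rewrite /translate/=.
by apply: filterS => k /=; rewrite addnA.
Qed.

Lemma betaN_closureP (C : set betaN) (p : betaN) :
  closure C p <-> forall A, p A -> exists2 q, C q & q A.
Proof.
split=> [clp A pA|Cp V].
  have [|q [Cq qA]] := clp (betaN_basic A); last by exists q.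
  have [op _] := betaN_basic_basis.
  by apply: open_nbhs_nbhs; split=> //; apply: op; exists A.
have [_ base] := betaN_basic_basis.
move=> /base[_ [[A _ <-] pA] AV]; have [q Cq qA] := Cp A pA.
by exists q; split=> //; exact: AV.
Qed.

Lemma closed_betaN_basic (A : set nat) : closed (betaN_basic A).
Proof.
move=> p /betaN_closureP clp.
have [//|/clp[q qA qnA]] := in_ultra_setVsetC A (betaN_ultra p).
by have [n []] := filter_ex (filterI qA qnA).
Qed.

(** An ultrafilter G of ultrafilters converges to the ultrafilter of the sets A
    that belong to G-almost every p. *)
Lemma betaN_compact : compact [set: betaN].
Proof.
rewrite compact_ultra => G GU _.
have Gp : UltraFilter [set A | G (betaN_basic A)].
  apply: ultra_of_dichotomy => [|A].
    apply: Build_ProperFilter; [move=> G0|split].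
    - have [p p0] := @filter_ex _ G _ _ G0.
      exact: (@filter_not_empty _ p _ p0).
    - by apply: (@filterE _ G) => p; exact: filterT.
    - move=> A B; apply: (@filterS2 _ G) => p pA pB.
      exact: (@filterI _ p).
    - by move=> A B AB; apply: (@filterS _ G) => p; exact: (@filterS _ p).
  have [|nGA] := in_ultra_setVsetC (betaN_basic A) GU; first by left.
  right; apply: filterS nGA => p npA.
  by have [//|] := in_ultra_setVsetC A (betaN_ultra p).
exists (BetaN Gp); split=> // V; have [_ base] := betaN_basic_basis.
by move=> /base[_ [[A _ <-] GA] AV]; exact: (@filterS _ G _ _ _ AV GA).
Qed.

Lemma directed_closed_nonempty (T : topologicalType) (I : Type) (D : set I)
    (C : I -> set T) :
  compact [set: T] -> D !=set0 -> (forall i, D i -> closed (C i)) ->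
  (forall i, D i -> C i !=set0) ->
  (forall i j, D i -> D j -> exists2 k, D k & C k `<=` C i `&` C j) ->
  \bigcap_(i in D) C i !=set0.
Proof.
move=> cT [i0 Di0] clC C0 dirC.
have FF : ProperFilter (filter_from D C).
  apply: filter_from_proper => //.
  by apply: filter_from_filter; first exists i0.
have [|p [_ clp]] := cT _ FF; first by exists i0.
exists p => i Di; apply: clC => // V Vp; apply: clp => //.
by exists i.
Qed.

(** Zorn's lemma below a given closed set, for a property Q of sets that is
    stable under nonempty intersections. It is used twice: with closed
    subsemigroups for the existence of idempotents, and with closed left
    ideals. *)
Lemma exists_minimal_closed (T : topologicalType) (Q : set (set T))
    (C : set T) :
  compact [set: T] ->
  (forall F : set (set T), F !=set0 -> F `<=` Q -> Q (\bigcap_(A in F) A)) ->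
  closed C -> C !=set0 -> Q C ->
  exists M, [/\ M `<=` C, closed M, M !=set0, Q M &
    forall N, N `<=` M -> closed N -> N !=set0 -> Q N -> N = M].
Proof.
move=> cT Qcap clC C0 QC.
(* The maximality principle is applied to the sets that are removed from C. *)
pose P (U : set T) := [/\ closed (C `\` U), C `\` U !=set0 & Q (C `\` U)].
have [F FP Ftot|U [[clM M0 QM] maxU]] := @Zorn_bigcup _ P.
  have [F0|/set0P/eqP Fe] := pselect (F !=set0); last first.
    rewrite (_ : F = set0) ?bigcup_set0 /P ?setD0//.
    by case: (eqVneq F set0) Fe.
  rewrite /P.
  have -> : C `\` \bigcup_(X in F) X = \bigcap_(X in F) (C `\` X).
    apply/seteqP; split=> [x [Cx nF] X FX|x FCx].
      by split=> // Xx; apply: nF; exists X.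
    have [X FX] := F0; have [Cx _] := FCx X FX; split=> // -[Y FY Yx].
    by have [] := FCx Y FY.
  split.
  - by apply: closed_bigI => X /FP[].
  - apply: directed_closed_nonempty => //; try by move=> X /FP[].
    move=> X Y FX FY; have [XY|YX] := Ftot X Y FX FY.
      by exists Y => // x [Cx nY]; split; split=> // /XY.
    by exists X => // x [Cx nX]; split; split=> // /YX.
  - rewrite -(bigcap_image F (fun X => C `\` X) id); apply: Qcap.
      by have [X FX] := F0; exists (C `\` X), X.
    by move=> _ [X /FP[_ _ QX] <-].
exists (C `\` U); split=> // N NM clN N0 QN.
apply/seteqP; split=> // x [Cx nUx]; apply: contrapT => nNx.
apply: (maxU (~` N)).
  split; first by move=> y Uy /NM[].
  by move/(_ x nNx).
by rewrite /P setDE setCK (_ : C `&` N = N)//; apply/setIidPr => y /NM[].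
Qed.

Lemma closed_preimage_addr (q : betaN) (C : set betaN) :
  closed C -> closed [set p | C (betaN_add p q)].
Proof.
move=> clC p /betaN_closureP clp; apply/clC/betaN_closureP => A.
by move=> /clp[r]; exists (betaN_add r q).
Qed.

(** If p is in the closure of C + q, then the closed sets of those r in C such
    that A is in r + q, for A in p, have the finite intersection property; a
    common element r satisfies r + q = p. *)
Lemma closed_image_addr (q : betaN) (C : set betaN) :
  closed C -> closed [set betaN_add p q | p in C].
Proof.
move=> clC p /betaN_closureP clp.
have [||A pA|A pA|A B pA pB|r rP] := @directed_closed_nonempty betaN _ p
  (fun A => C `&` betaN_basic [set n | q (translate n A)]).
- exact: betaN_compact.
- by exists setT; exact: filterT.
- by apply: closedI => //; exact: closed_betaN_basic.
- by have [_ [r Cr <-] rA] := clp A pA; exists r.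
- exists (A `&` B); first exact: filterI.
  move=> r [Cr rAB]; split; split=> //; apply: filterS rAB => n /=;
  by apply: filterS => m [].
have [Cr _] := rP setT filterT; exists r => //.
by apply/esym/betaN_sub_eq => A /rP[].
Qed.

Lemma closed_betaN_set1 (p : betaN) : closed [set p].
Proof.
move=> q /betaN_closureP clq; apply: betaN_sub_eq => A /clq[_ ->//].
Qed.

Definition add_closed (C : set betaN) :=
  forall p q, C p -> C q -> C (betaN_add p q).

(** The Ellis-Numakura lemma. In a minimal closed subsemigroup M with p in M,
    the closed subsemigroup M + p is all of M, so the set of the a in M with
    a + p = p is nonempty; it is a closed subsemigroup, hence equal to M,
    and contains p. *)
Lemma exists_idempotent (S : set betaN) :
  closed S -> S !=set0 -> add_closed S ->
  exists2 p, S p & betaN_add p p = p.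
Proof.
move=> clS S0 addS.
have [F _ FQ p q Fp Fq C FC|M [MS clM [p Mp] addM minM]] :=
  exists_minimal_closed (Q := add_closed) betaN_compact _ clS S0 addS.
  by apply: FQ => //; [exact: Fp|exact: Fq].
have MpM : [set betaN_add a p | a in M] = M.
  apply: minM; first by move=> _ [a Ma <-]; exact: addM.
  - exact: closed_image_addr.
  - by exists (betaN_add p p), p.
  - move=> _ _ [a Ma <-] [b Mb <-].
    exists (betaN_add (betaN_add a p) b); last by rewrite betaN_addA.
    by apply: (addM _ _ _ Mb); exact: addM.
pose N := M `&` [set a | [set p] (betaN_add a p)].
have NM : N = M.
  apply: minM; first by move=> a [].
  - apply: closedI => //; apply: closed_preimage_addr.
    exact: closed_betaN_set1.
  - by move: Mp; rewrite -{1}MpM => -[a Ma ap]; exists a.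
  - move=> a b [Ma /= ap] [Mb /= bp]; split; first exact: addM.
    by rewrite /= -betaN_addA bp.
by exists p; [exact: MS|move: Mp; rewrite -NM => -[]].
Qed.

(** * Left ideals and the closure of the smallest ideal *)

Definition left_ideal (C : set betaN) :=
  forall p q, C q -> C (betaN_add p q).

Definition minimal_left_ideal (L : set betaN) :=
  [/\ L !=set0, left_ideal L &
    forall C, C `<=` L -> C !=set0 -> left_ideal C -> C = L].

Lemma left_ideal_image_addr (p : betaN) :
  left_ideal [set betaN_add r p | r in [set: betaN]].
Proof.
by move=> q _ [r _ <-]; rewrite betaN_addA; exists (betaN_add q r).
Qed.

(** A left ideal that is minimal among the closed ones is minimal among all
    left ideals, because every left ideal that contains p contains the closed
    left ideal of the r + p. *)
Lemma exists_minimal_left_ideal (C : set betaN) :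
  closed C -> C !=set0 -> left_ideal C ->
  exists2 L, L `<=` C & minimal_left_ideal L.
Proof.
move=> clC C0 lC.
have [F _ FQ p q Fq D FD|L [LC clL L0 lL minL]] :=
  exists_minimal_closed (Q := left_ideal) betaN_compact _ clC C0 lC.
  by apply: FQ => //; exact: Fq.
exists L => //; split=> // N NL [p Np] lN; apply/seteqP; split=> //.
rewrite -(minL [set betaN_add r p | r in [set: betaN]]).
- by move=> _ [r _ <-]; exact: lN.
- by move=> _ [r _ <-]; apply/lL/NL.
- by apply: closed_image_addr; exact: closedT.
- by exists (betaN_add p p), p.
- exact: left_ideal_image_addr.
Qed.

(** A two-sided ideal I meets a left ideal L, since it contains i + l for i in
    I and l in L; by minimality of L, the left ideal I `&` L is L. *)
Lemma minimal_left_ideal_sub_K (L : set betaN) :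
  minimal_left_ideal L -> L `<=` betaN_K.
Proof.
move=> [[l Ll] lL minL] p Lp I [[i Ii] idI].
suff LI : I `&` L = L by move: Lp; rewrite -LI => -[].
apply: minL; first by move=> q [].
- by exists (betaN_add i l); split; [case: (idI l i Ii)|exact: lL].
- by move=> q r [Ir Lr]; split; [case: (idI q r Ir)|exact: lL].
Qed.

Definition piecewise_syndetic_ultra : set betaN :=
  [set p : betaN | forall A, p A -> piecewise_syndetic A].

Lemma piecewise_syndetic_ultra_ideal (p q : betaN) :
  piecewise_syndetic_ultra q ->
  piecewise_syndetic_ultra (betaN_add p q) /\
  piecewise_syndetic_ultra (betaN_add q p).
Proof.
move=> psq; split=> A; last first.
  by move=> /psq; apply: piecewise_syndetic_translate_mem.
move=> pqA; have [n qn] := @filter_ex _ p _ _ pqA.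
exact: piecewise_syndetic_translate (psq _ qn).
Qed.

(** Thickness of B says that any finitely many translates of B have a common
    point. *)
Lemma exists_thick_ultra (B : set nat) :
  thick B -> exists p : betaN, forall n, p (translate n B).
Proof.
move=> thB; pose C L := [set m | forall n, n <= L -> B (n + m)].
have FF : ProperFilter (filter_from setT C).
  apply: filter_from_proper => [|L _].
    apply: filter_from_filter; first by exists 0.
    move=> i j _ _; exists (maxn i j) => // m Cm.
    by split=> n nL; apply: Cm; rewrite leq_max nL ?orbT.
  have [m mB] := thB L.+1 isT; exists m => n nL.
  by rewrite addnC; apply: mB; exact: leqW.
have [G [GU FG]] := ultraFilterLemma FF.
exists (BetaN GU) => n; apply: FG; exists n => // m Cm.
exact: Cm.
Qed.

(** If the n with -n+A in p had unbounded gaps, some ultrafilter r would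
    contain all translates of the complement of this set, and A would belong
    to no element s + (r + p). But by minimality these elements exhaust L,
    which contains p. *)
Lemma minimal_left_ideal_syndetic (L : set betaN) (p : betaN) (A : set nat) :
  minimal_left_ideal L -> L p -> p A -> syndetic [set n | p (translate n A)].
Proof.
move=> [_ lL minL] Lp pA; apply: contrapT => nsynd.
set S := [set n | _] in nsynd.
have /exists_thick_ultra[r rS] : thick (~` S).
  move=> l l0; apply: contrapT => nth; apply: nsynd; exists l => // n.
  apply: contrapT => nS; apply: nth; exists n => k kl Sk; apply: nS.
  by exists k.
have : [set betaN_add s (betaN_add r p) | s in [set: betaN]] = L.
  apply: minL.
  - by move=> _ [s _ <-]; apply/lL/lL.
  - by exists (betaN_add p (betaN_add r p)), p.
  - exact: left_ideal_image_addr.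
move=> Lrp; move: Lp; rewrite -Lrp => -[s _ srp].
move: pA; rewrite -srp => pA; have [m rm] := @filter_ex _ s _ _ pA.
have [k [Smk nSmk]] := @filter_ex _ r _ _ (@filterI _ r _ _ _ rm (rS m)).
apply: nSmk; apply: filterS Smk => j.
by rewrite /translate/= addnA.
Qed.

Lemma syndetic_piecewise_syndetic (A : set nat) :
  syndetic A -> piecewise_syndetic A.
Proof.
move=> synA; exists setT, A; split=> //; last by rewrite setTI.
by move=> L _; exists 0.
Qed.

(** The ultrafilters with piecewise syndetic members satisfy the closure
    property of an ideal; what remains is that there is one, and any element
    of a minimal left ideal will do. *)
Lemma betaN_K_piecewise_syndetic : betaN_K `<=` piecewise_syndetic_ultra.
Proof.
move=> p; apply; split; last first.
  by move=> {}p q; exact: piecewise_syndetic_ultra_ideal.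
have [//||//|L _ minL] := @exists_minimal_left_ideal setT.
  by exists (BetaN (principal_filter_ultra 0)).
have [[q Lq] _ _] := minL; exists q => A qA.
apply: (@piecewise_syndetic_translate_mem q).
exact/syndetic_piecewise_syndetic/(minimal_left_ideal_syndetic minL Lq).
Qed.

(** For A = B `&` C as in the definition, the minimal left ideal L is chosen
    so that B belongs to all its elements. The syndetic set C has, for
    any r in L, a translate -k+C in r; then C is in k + r, which is in L. *)
Lemma piecewise_syndetic_K (A : set nat) :
  piecewise_syndetic A -> exists2 p, betaN_K p & p A.
Proof.
move=> [B [C [/exists_thick_ultra[q qB] [g _ synC] ->]]].
pose J := \bigcap_n betaN_basic (translate n B).
have [|||L LJ minL] := @exists_minimal_left_ideal J.
- by apply: closed_bigI => n _; exact: closed_betaN_basic.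
- by exists q => n _; exact: qB.
- move=> p r Jr n _; apply: (@filterE _ p) => m /=.
  apply: (@filterS _ r _ _ _ _ (Jr (n + m) I)) => k.
  by rewrite /translate/= addnA.
have [[r Lr] lL _] := minL.
have [[k kg rk]|nrk] := pselect (exists2 k, k <= g & r (translate k C)).
  pose pk := BetaN (principal_filter_ultra k).
  have Lkr : L (betaN_add pk r) by exact: lL.
  exists (betaN_add pk r); first exact: minimal_left_ideal_sub_K Lkr.
  apply: (@filterI _ (betaN_add pk r)); first by have := LJ _ Lkr 0 I.
  exact/principal_filterP.
have /filter_ex[n nC] : r [set n | forall k, k <= g -> ~ C (k + n)].
  apply: filter_forall_leq => k kg.
  have [rk|//] := in_ultra_setVsetC (translate k C) (betaN_ultra r).
  by case: nrk; exists k.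
have [k kg Cnk] := synC n.
by case: (nC k kg); rewrite addnC.
Qed.

Lemma closure_betaN_KE : closure betaN_K = piecewise_syndetic_ultra.
Proof.
apply/seteqP; split=> p; first move=> /betaN_closureP clp A /clp[q].
  by move=> /betaN_K_piecewise_syndetic; exact.
by move=> psp; apply/betaN_closureP => A /psp; exact: piecewise_syndetic_K.
Qed.

(** * Return times of piecewise syndetic recurrent points *)

Lemma translate_return_times (X : Type) (T : X -> X) (x : X) (U : set X) n :
  translate n (return_times T x U) = return_times T x (iter n T @^-1` U).
Proof. by apply/funext => m; rewrite /translate /return_times /= iterD. Qed.

Lemma return_times_quasi_central (X : topologicalType) (T : X -> X) (x : X) :
  continuous T -> piecewise_syndetic_recurrent T x ->
  forall U : set X, open_nbhs x U -> quasi_central (return_times T x U).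
Proof.
move=> cT recx U xU.
have iterT_cont n : continuous (iter n T).
  elim: n => [|n IH] y; first exact: cvg_id.
  exact: (@continuous_comp _ _ _ (iter n T) T y (IH y) (cT _)).
pose S : set betaN := closure betaN_K `&`
  \bigcap_(V in open_nbhs x) betaN_basic (return_times T x V).
have [|||p [Kp pS] pp] := @exists_idempotent S; last first.
- by exists p; split=> //; exact: pS.
- move=> p q [Kp pS] [Kq qS]; split.
    move: Kq; rewrite closure_betaN_KE.
    by move=> /(piecewise_syndetic_ultra_ideal p)[].
  move=> V xV; apply: (@filterS _ p _ _ _ _ (pS V xV)) => n Vn.
  have xnV : open_nbhs x (iter n T @^-1` V).
    split=> //; case: xV => oV _; apply: open_comp => //.
  by rewrite /= translate_return_times; exact: qS.
- have [||V xV|V xV|V W xV xW|p pS] := @directed_closed_nonempty betaN _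
    (open_nbhs x)
    (fun V => closure betaN_K `&` betaN_basic (return_times T x V)).
  + exact: betaN_compact.
  + by exists U.
  + by apply: closedI; [exact: closed_closure|exact: closed_betaN_basic].
  + have [p Kp pV] := piecewise_syndetic_K (recx V xV).
    by exists p; split=> //; exact: subset_closure.
  + exists (V `&` W); first exact: open_nbhsI.
    by move=> p [Kp pVW]; split; split=> //; apply: filterS pVW => n [].
  + by exists p; split=> [|V /pS[]//]; have [] := pS U xU.
- apply: closedI; first exact: closed_closure.
  by apply: closed_bigI => V _; exact: closed_betaN_basic.
Qed.
(** * The shift on the Cantor space *)

(** The field R is a phantom parameter, so that the R-valued metric below can
    be attached to the type. *)
Definition cantor_seq (R : realType) := nat -> bool.

HB.instance Definition _ (R : realType) := gen_eqMixin (cantor_seq R).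
HB.instance Definition _ (R : realType) := gen_choiceMixin (cantor_seq R).

Section CantorMetric.
Import Order.TTheory GRing.Theory Num.Theory.
Local Open Scope ring_scope.
Variable R : realType.
Implicit Types x y z : cantor_seq R.

Definition cantor_dist x y : R :=
  if pselect (exists n, x n != y n) is left h then (ex_minn h).+1%:R^-1 else 0.

Lemma cantor_dist_ltP x y n :
  cantor_dist x y < n.+1%:R^-1 <-> forall i, (i <= n)%N -> x i = y i.
Proof.
rewrite /cantor_dist; case: pselect => [h|nh]; last first.
  split=> _; last by rewrite invr_gt0 ltr0n.
  by move=> i _; apply: contrapT => xy; apply: nh; exists i; apply/eqP.
case: ex_minnP => m xym minm; rewrite ltf_pV2 ?posrE ?ltr0n// ltr_nat ltnS.
split=> [nm i ni|xy].
  by apply/eqP/negPn/negP => /minm; rewrite leqNgt (leq_ltn_trans ni).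
by rewrite ltnNge; apply/negP => /xy /eqP; rewrite (negbTE xym).
Qed.

Lemma cantor_dist_val x y :
  (exists n, cantor_dist x y = n.+1%:R^-1) \/ cantor_dist x y = 0.
Proof.
rewrite /cantor_dist; case: pselect => h; last by right.
by left; exists (ex_minn h).
Qed.

Lemma cantor_distxx x : cantor_dist x x = 0.
Proof.
rewrite /cantor_dist; case: pselect => // h.
by case: ex_minnP => n; rewrite eqxx.
Qed.

Lemma cantor_dist_ge0 x y : 0 <= cantor_dist x y.
Proof.
by have [[n ->]|->//] := cantor_dist_val x y; rewrite invr_ge0 ler0n.
Qed.

Lemma cantor_dist_eq0 x y : cantor_dist x y = 0 -> x = y.
Proof.
move=> xy0; apply/funext => n; apply: (cantor_dist_ltP x y n).1 (leqnn n).
by rewrite xy0 invr_gt0 ltr0n.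
Qed.

Lemma cantor_dist_le_max y x z :
  cantor_dist x z <= Num.max (cantor_dist x y) (cantor_dist y z).
Proof.
have [[n xzn]|->] := cantor_dist_val x z; last first.
  by rewrite le_max cantor_dist_ge0.
rewrite leNgt xzn gt_max; apply/negP => /andP[/cantor_dist_ltP xy].
move=> /cantor_dist_ltP yz.
have /cantor_dist_ltP : forall i, (i <= n)%N -> x i = z i.
  by move=> i ni; rewrite xy// yz.
by rewrite xzn ltxx.
Qed.

Lemma cantor_dist_sym x y : cantor_dist x y = cantor_dist y x.
Proof.
suff le a b : cantor_dist a b <= cantor_dist b a.
  by apply/eqP; rewrite eq_le !le.
have [[n abn]|->] := cantor_dist_val a b; last exact: cantor_dist_ge0.
rewrite leNgt abn; apply/negP => /cantor_dist_ltP ba.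
have /cantor_dist_ltP : forall i, (i <= n)%N -> a i = b i by move=> i /ba.
by rewrite abn ltxx.
Qed.

Lemma cantor_dist_triangle y x z :
  cantor_dist x z <= cantor_dist x y + cantor_dist y z.
Proof.
rewrite (le_trans (cantor_dist_le_max y x z))// ge_max.
by rewrite lerDl lerDr !cantor_dist_ge0.
Qed.

HB.instance Definition _ := @isMetric.Build R (cantor_seq R) cantor_dist
  cantor_distxx cantor_dist_eq0 cantor_dist_sym cantor_dist_triangle.

Lemma nbhs_cantorP x (V : set (cantor_seq R)) :
  nbhs x V <-> exists n, forall y, (forall i, (i <= n)%N -> x i = y i) -> V y.
Proof.
have ballE e : ball x e = [set y | cantor_dist x y < e] by rewrite ballEmdist.
split=> [/nbhs_ballP[e /= e0 xeV]|[n nV]].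
  have [n ne] : exists n : nat, n.+1%:R^-1 < e.
    exists (Num.trunc e^-1).
    rewrite -[ltRHS]invrK ltf_pV2 ?posrE ?ltr0n ?invr_gt0//.
    by rewrite truncnS_gt.
  exists n => y /cantor_dist_ltP xy; apply: xeV.
  by rewrite ballE; exact: lt_trans ne.
apply/nbhs_ballP; exists n.+1%:R^-1 => /=; first by rewrite invr_gt0 ltr0n.
by rewrite ballE => y /= /cantor_dist_ltP; exact: nV.
Qed.

Definition cantor_shift (x : cantor_seq R) : cantor_seq R := fun n => x n.+1.

Lemma iter_cantor_shift n x i : iter n cantor_shift x i = x (n + i)%N.
Proof. by elim: n i => [//|n IH] i; rewrite iterS /cantor_shift IH addnS. Qed.

Lemma cantor_shift_continuous : continuous cantor_shift.
Proof.
move=> x V /nbhs_cantorP[n nV]; apply/nbhs_cantorP; exists n.+1 => y xy.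
by apply: nV => i ni; exact: xy.
Qed.

(** An ultrafilter converges to the sequence of its limits in each
    coordinate. *)
Lemma cantor_compact : compact [set: cantor_seq R].
Proof.
rewrite compact_ultra => G GU _.
pose x : cantor_seq R := fun i => `[< G [set y | y i] >].
exists x; split=> // V /nbhs_cantorP[n nV].
have Gx : G [set y | forall i, (i <= n)%N -> x i = y i].
  apply: filter_forall_leq => i _; rewrite /x; case: asboolP => [|nGi].
    by apply: filterS => y /= ->.
  have [//|] := in_ultra_setVsetC [set y : cantor_seq R | y i] GU.
  by apply: filterS => y /= /negP/negbTE ->.
exact: filterS nV Gx.
Qed.

End CantorMetric.

(** * Recurrent sequences supported in a given set *)

(** Position 0 is exempt, since the point to be built must have a one there
    whether or not 0 is in S. *)
Definition word_supported (S : set nat) (w : seq bool) :=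
  forall i, 0 < i -> nth false w i -> S i.

(** Position 0 is not exempt here: its letter is copied to the position n
    itself. *)
Definition placements (S : set nat) (u : seq bool) : set nat :=
  [set n | forall i, nth false u i -> S (n + i)].

Definition occurs_at (u w : seq bool) (n : nat) :=
  n + size u <= size w /\
  forall i, i < size u -> nth false w (n + i) = nth false u i.

Lemma nth_prefix (u w : seq bool) i :
  prefix u w -> i < size u -> nth false w i = nth false u i.
Proof. by move=> /prefixP[s ->] iu; rewrite nth_cat iu. Qed.

Lemma occurs_at_prefix (u w w' : seq bool) n :
  prefix w w' -> occurs_at u w n -> occurs_at u w' n.
Proof.
move=> ww' [nuw uE]; split; first exact: leq_trans (size_prefix ww').
move=> i iu; rewrite (nth_prefix ww') ?uE//.
by apply: leq_trans nuw; rewrite ltn_add2l.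
Qed.

Lemma word_supported_take (S : set nat) (w : seq bool) k :
  word_supported S w -> word_supported S (take k w).
Proof.
move=> Sw i i0; have [ik|ki] := ltnP i k.
  by rewrite nth_take//; exact: Sw.
by rewrite nth_default// size_take_min (leq_trans (geq_minl _ _)).
Qed.

Lemma place_word (S : set nat) (u w : seq bool) n :
  word_supported S w -> placements S u n -> size w <= n ->
  exists w', [/\ word_supported S w', prefix w w', size w' = n + size u &
    occurs_at u w' n].
Proof.
move=> Sw un wn; exists (w ++ nseq (n - size w) false ++ u); split.
- move=> i i0; rewrite nth_cat; case: ltnP => [_|wi]; first exact: Sw.
  rewrite nth_cat size_nseq nth_nseq; case: ltnP => [//|nwi].
  by move=> /un; congr S; lia.
- exact: prefix_prefix.
- by rewrite !size_cat size_nseq; lia.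
- split=> [|i iu]; first by rewrite !size_cat size_nseq; lia.
  rewrite nth_cat ltnNge (leq_trans wn) ?leq_addr//= nth_cat size_nseq.
  rewrite ltnNge leq_sub2r ?leq_addr//=; congr nth; lia.
Qed.

(** Appends j copies of u, one in each of j consecutive windows of length
    g + size u that start at a. A copy that begins at an offset of at
    most g in its window ends inside it, so the copies do not overlap. *)
Lemma place_words (S : set nat) (u w : seq bool) g a j :
  word_supported S w -> size w <= a ->
  (forall i, i <= j * (g + size u) ->
    exists2 k, k <= g & placements S u (a + i + k)) ->
  exists w', [/\ word_supported S w', prefix w w',
    size w' <= a + j * (g + size u) &
    forall i, i < j -> exists2 k, k <= g &
      occurs_at u w' (a + i * (g + size u) + k)].
Proof.
move=> Sw wa; elim: j => [|j IH] gap.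
  by exists w; split=> //; rewrite ?prefix_refl// addn0.
have [|w1 [Sw1 ww1 w1j occ]] := IH.
  by move=> i ij; apply: gap; rewrite mulSn (leq_trans ij)// leq_addl.
have [|k kg uk] := gap (j * (g + size u)); first by rewrite mulSn leq_addl.
have [|w2 [Sw2 w12 w2n occ2]] := place_word Sw1 uk.
  by rewrite (leq_trans w1j)// leq_addr.
exists w2; split=> //; first exact: prefix_trans w12.
  by rewrite w2n mulSn; lia.
move=> i; rewrite ltnS leq_eqVlt => /orP[/eqP ->|/occ[l lg occl]].
  by exists k.
by exists l => //; exact: occurs_at_prefix occl.
Qed.

(** Stage m extends the word W m by m + 1 copies of its prefix of length
    k + 1, where k is the 2-adic valuation of m + 1. Thus every prefix of the
    limit x is copied at infinitely many stages. The gap between the copies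
    depends on the copied prefix alone, as piecewise syndeticity requires. *)
Lemma exists_recurrent_sequence (S : set nat) :
  (forall u, word_supported S u -> piecewise_syndetic (placements S u)) ->
  exists x : nat -> bool,
    [/\ x 0, forall i, 0 < i -> x i -> S i &
      forall n, piecewise_syndetic
        [set m | forall i, i <= n -> x (m + i) = x i]].
Proof.
move=> psS.
have /choice[gap gapP] u : exists g, word_supported S u ->
    forall M, exists a, forall i, i <= M ->
      exists2 k, k <= g & placements S u (a + i + k).
  have [/psS/piecewise_syndeticP[g gP]|nSu] := pselect (word_supported S u).
    by exists g.
  by exists 0.
pose V u := gap u + size u.
have step (mw : nat * {w | word_supported S w}) :
    exists w' : {w | word_supported S w},
    let u := take (logn 2 mw.1.+1).+1 (sval mw.2) in
    [/\ prefix (sval mw.2) (sval w'), mw.1.+1 < size (sval w') &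
      exists a, forall i, i <= mw.1 -> exists2 k, k <= gap u &
        occurs_at u (sval w') (a + i * V u + k)].
  case: mw => m [w Sw] /=; set u := take _ _.
  have Su : word_supported S u by exact: word_supported_take.
  (* Shifting the windows by m.+2 makes the word longer than the stage number,
     and shifting them by size w leaves the current word untouched. *)
  have [a gapu] := gapP u Su (m.+1 * V u + m.+2 + size w).
  have [||w' [Sw' ww' _ occ]] :=
    @place_words S u w (gap u) (a + m.+2 + size w) m.+1 Sw.
  - exact: leq_addl.
  - move=> i ij; have [|k kg uk] := gapu (m.+2 + size w + i).
      by rewrite addnC addnA leq_add2r leq_add2r.
    by exists k => //; rewrite -!addnA in uk *.
  exists (exist _ w' Sw'); split=> //=; last first.
    by exists (a + m.+2 + size w) => i; exact: occ.
  have [k _ [+ _]] := occ 0 isT; lia.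
have S1 : word_supported S [:: true] by move=> [|[|i]].
have /choice[next nextP] := step.
pose fix w m : {w | word_supported S w} :=
  if m is m'.+1 then next (m', w m') else exist _ _ S1.
pose W m := sval (w m).
have W_prefix m n : m <= n -> prefix (W m) (W n).
  elim: n => [|n IH]; first by rewrite leqn0 => /eqP ->; exact: prefix_refl.
  rewrite leq_eqVlt => /orP[/eqP ->|/IH Wmn]; first exact: prefix_refl.
  by have [Wn _ _] := nextP (n, w n); exact: prefix_trans Wn.
have W_size m : m < size (W m).
  by case: m => // m; have [_ + _] := nextP (m, w m).
pose x i := nth false (W i) i.
have WE m i : i < size (W m) -> nth false (W m) i = x i.
  move=> iWm; have [mi|im] := leqP m i.
    by rewrite /x (nth_prefix (W_prefix _ _ mi)).
  by rewrite /x (nth_prefix (W_prefix _ _ (ltnW im))).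
exists x; split=> // [i i0|n]; first exact: (svalP (w i)).
pose u := mkseq x n.+1.
have uE m : n <= m -> take n.+1 (W m) = u.
  move=> nm; have nWm : n < size (W m) by exact: leq_ltn_trans (W_size m).
  apply: (@eq_from_nth _ false); first by rewrite size_mkseq size_takel.
  move=> i; rewrite size_takel// => ni.
  by rewrite nth_mkseq// nth_take// WE// (leq_trans ni).
have V0 : 0 < V u by rewrite /V size_mkseq addnS.
apply/piecewise_syndeticP; exists (V u + gap u) => M.
(* A stage at which u is copied, late enough to give more than M copies. *)
pose m := (2 ^ n * (M.+1.*2.+1)).-1.
have mS : m.+1 = 2 ^ n * (M.+1.*2.+1) by rewrite prednK// muln_gt0 expn_gt0.
have mn : logn 2 m.+1 = n.
  rewrite mS lognM ?expn_gt0// lognX logn_prime// eqxx muln1.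
  by rewrite lognE dvdn2 /= odd_double /= addn0.
have Mm : M < m by rewrite -ltnS mS; have := expn_gt0 2 n; nia.
have nm : n <= m by rewrite -ltnS mS; have := ltn_expl n (isT : 1 < 2); nia.
have [_ _ [a]] := nextP (m, w m).
rewrite /= mn -/(W m) uE// => occ; exists a => t tM.
(* The copy in the window after that of t starts at or after t. *)
have [|k kg [kW uk]] := occ (t %/ V u).+1.
  by rewrite (leq_trans _ Mm)// ltnS (leq_trans (leq_div _ _)).
have tV := ltn_pmod t V0; have tE := divn_eq t (V u).
exists (V u - t %% V u + k); first by rewrite leq_add// leq_subr.
have -> : a + t + (V u - t %% V u + k) = a + (t %/ V u).+1 * V u + k.
  by rewrite mulSn {1}tE; lia.
move=> i ni; have iu : i < size u by rewrite size_mkseq.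
rewrite -(WE m.+1); last by apply: leq_trans kW; rewrite ltn_add2l.
by rewrite uk// nth_mkseq.
Qed.

(** The set S of the n in F with -n+F in p has the property that -n+S is in p
    for every n in S, because p is idempotent. So the placements of a word
    supported in S contain a finite intersection of members of p. *)
Lemma recurrent_point_of_quasi_central (F : set nat) :
  quasi_central F ->
  exists x : nat -> bool,
    [/\ x 0, forall i, 0 < i -> x i -> F i &
      forall n, piecewise_syndetic
        [set m | forall i, i <= n -> x (m + i) = x i]].
Proof.
move=> [p []]; rewrite closure_betaN_KE => psp pp pF.
pose S := F `&` [set n | p (translate n F)].
have pS : p S.
  by apply: (@filterI _ p) => //; move: pF; rewrite -{1}pp.
have pSn n : S n -> p (translate n S).
  move=> [_ pnF]; apply: (@filterI _ p) => //.
  move: pnF; rewrite -{1}pp; apply: (@filterS _ p) => m /=.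
  by apply: (@filterS _ p) => k; rewrite /translate/= addnA.
have [u Su|x [x0 xS recx]] := @exists_recurrent_sequence S.
  apply: psp; rewrite /placements.
  have : p [set n | forall i, i <= size u -> nth false u i -> S (n + i)].
    apply: filter_forall_leq => i _; case: (nth false u i) (Su i); last first.
      by move=> _; apply: (@filterE _ p).
    case: i => [_|i Si].
      by apply: (@filterS _ p _ _ _ _ pS) => n Sn _; rewrite addn0.
    apply: (@filterS _ p _ _ _ _ (pSn _ (Si isT isT))) => n Sn _.
    by rewrite addnC.
  apply: (@filterS _ p) => n un i ui; apply: un => //.
  by rewrite leqNgt; apply: contraTN ui => ui; rewrite nth_default// ltnW.
by exists x; split=> // i i0 /(xS i i0)[].
Qed.

Theorem theorem1p2 (R : realType) :
  (forall (X : metricType R) (T : X -> X) (x : X),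
     topological_dynamical_system T ->
     piecewise_syndetic_recurrent T x ->
     forall U : set X, open_nbhs x U -> quasi_central (return_times T x U))
  /\
  (forall F : set nat, quasi_central F ->
     exists (X : metricType R) (T : X -> X) (x : X) (U : set X),
       [/\ topological_dynamical_system T,
           piecewise_syndetic_recurrent T x,
           open_nbhs x U
         & return_times T x U `<=` F `|` [set 0%N]]).
Proof.
split=> [X T x [_ cT]|F /recurrent_point_of_quasi_central[x [x0 xF recx]]].
  exact: return_times_quasi_central.
exists (cantor_seq R), (@cantor_shift R), x, [set y : cantor_seq R | y 0].
split.
- by split; [exact: cantor_compact|exact: cantor_shift_continuous].
- move=> U /open_nbhs_nbhs/nbhs_cantorP[n nU].
  apply: piecewise_syndeticS (recx n) => m xm.
  by apply: nU => i /xm <-; rewrite iter_cantor_shift.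
- split=> //; rewrite openE => y /= y0; apply/nbhs_cantorP.
  by exists 0 => z /(_ 0 isT) yz; rewrite /= -yz.
- move=> [|n]; first by right.
  rewrite /return_times /mkset iter_cantor_shift addn0 => xn.
  by left; exact: xF.
Qed.
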